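(* Let $L$ be a finite lattice. The clone $\mathsf{Id}(L)$ of all idempotent aggregation functions on $L$ is generated by the binary lattice operations $\vee$ and $\wedge$ together with the ternary functions $\iota_{(a,b,c),d}$, where $a,b,c,d\in L$ with $a\leq b\leq c$ and $a\leq d\leq c$. Moreover, if $n\geq 1$ and $f\colon L^n\to L$ is an idempotent aggregation function, then $$f(\mathbf{x})=\bigwedge_{\mathbf{a}\in L^n}\Big(\bigvee_{i=1}^n \iota_{(\bigwedge\mathbf{a},\,a_i,\,\bigvee\mathbf{a}),\,f(\mathbf{a})}\big(\bigwedge\mathbf{x},\,x_i,\,\bigvee\mathbf{x}\big)\Big)$$ for all $\mathbf{x}=(x_1,\dots,x_n)\in L^n$.
   Context: A finite lattice $L$ is bounded, with least element $0$ and greatest element $1$; $L^n$ carries the component-wise order. For $n\ge 1$, an $n$-ary aggregation function on $L$ is a function $A\colon L^n\to L$ that is nondecreasing ($\mathbf{x}\leq\mathbf{y}$ implies $A(\mathbf{x})\leq A(\mathbf{y})$) and satisfies $A(0,\dots,0)=0$, $A(1,\dots,1)=1$. It is idempotent if $A(x,\dots,x)=x$ for all $x\in L$. $\mathsf{Id}(L)$ is the set of all idempotent aggregation functions on $L$ of all arities $n\geq 1$. Composition of a $k$-ary function $f$ with $n$-ary functions $g_1,\dots,g_k$ is the $n$-ary function $\mathbf{x}\mapsto f(g_1(\mathbf{x}),\dots,g_k(\mathbf{x}))$. A clone on $L$ is a set of finitary functions (arities $\geq 1$) on $L$ closed under composition and containing all projections $p_i^n(x_1,\dots,x_n)=x_i$.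 A clone is generated by a set of functions if it is the least clone containing that set. For $a,b,c,d\in L$ with $a\leq b\leq c$ and $a\leq d\leq c$, the function $\iota_{(a,b,c),d}\colon L^3\to L$ is defined by $\iota_{(a,b,c),d}(x_1,x_2,x_3)=d\wedge(x_1\vee x_2\vee x_3)$ if $(x_1,x_2,x_3)\leq(a,b,c)$, and $\iota_{(a,b,c),d}(x_1,x_2,x_3)=x_1\vee x_2\vee x_3$ otherwise. For $\mathbf{a}=(a_1,\dots,a_n)\in L^n$, $\bigwedge\mathbf{a}$ denotes $\bigwedge_{i=1}^n a_i$ and $\bigvee\mathbf{a}$ denotes $\bigvee_{i=1}^n a_i$. (For an idempotent aggregation function $f$ one has $\bigwedge\mathbf{a}\leq f(\mathbf{a})\leq\bigvee\mathbf{a}$, so the $\iota$-functions in the formula are of the kind $\iota_{(a,b,c),d}$ with $a\leq b\leq c$ and $a\leq d\leq c$, where $a=\bigwedge\mathbf{a}$, $b=a_i$, $c=\bigvee\mathbf{a}$ and $d=f(\mathbf{a})$.) *)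

(* Defs.v *)
From mathcomp Require Import all_boot all_order.
Set Implicit Arguments.
Unset Strict Implicit.
Unset Printing Implicit Defensive.
Import Order.TTheory.
Local Open Scope order_scope.

(* [L ^ n] is MathComp's notation for {ffun 'I_n -> L}; taking finite functions
   (rather than plain ones) makes equality of operations extensional. *)
Definition op (L : finType) (n : nat) : Type := {ffun (L ^ n)%type -> L}.

Section Clones.

Variable L : finType.

Definition op_set : Type := forall n : nat, op L n -> Prop.

Definition op_subset (C D : op_set) : Prop :=
  forall (n : nat) (f : op L n), C n f -> D n f.

Definition proj (n : nat) (i : 'I_n) : op L n := [ffun x : (L ^ n)%type => x i].

Definition comp (k n : nat) (f : op L k) (g : 'I_k -> op L n) : op L n :=
  [ffun x : (L ^ n)%type => f [ffun i => g i x]].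

Definition positive_arity (C : op_set) : Prop :=
  forall (n : nat) (f : op L n), C n f -> (0 < n)%N.

Definition is_clone (C : op_set) : Prop :=
  [/\ positive_arity C,
      forall (n : nat) (i : 'I_n), C n (proj i)
    & forall (k n : nat) (f : op L k) (g : 'I_k -> op L n),
        C k f -> (forall i, C n (g i)) -> C n (comp f g)].

Definition generated_by (C G : op_set) : Prop :=
  [/\ is_clone C, op_subset G C
    & forall D : op_set, is_clone D -> op_subset G D -> op_subset C D].

End Clones.

Section Aggregation.

Variables (disp : Order.disp_t) (L : finTBLatticeType disp).

Definition aggregation (n : nat) (f : op L n) : Prop :=
  [/\ forall x y : (L ^ n)%type, (forall i, x i <= y i) -> f x <= f y,
      f [ffun=> \bot] = \bot
    & f [ffun=> \top] = \top].

Definition idempotent_op (n : nat) (f : op L n) : Prop :=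
  forall x : L, f [ffun=> x] = x.

Definition idempotent_aggregation (n : nat) (f : op L n) : Prop :=
  aggregation f /\ idempotent_op f.

Definition Id : op_set L :=
  fun n f => (0 < n)%N /\ idempotent_aggregation f.

Definition iota_fun (a b c d x1 x2 x3 : L) : L :=
  if [&& x1 <= a, x2 <= b & x3 <= c]
  then d `&` (x1 `|` x2 `|` x3)
  else x1 `|` x2 `|` x3.

Definition op2 (h : L -> L -> L) : op L 2 :=
  [ffun x : (L ^ 2)%type => h (x (inord 0)) (x (inord 1))].

Definition op3 (h : L -> L -> L -> L) : op L 3 :=
  [ffun x : (L ^ 3)%type => h (x (inord 0)) (x (inord 1)) (x (inord 2))].

Inductive Id_generators : op_set L :=
| Gen_join : Id_generators (op2 (fun x y => x `|` y))
| Gen_meet : Id_generators (op2 (fun x y => x `&` y))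
| Gen_iota (a b c d : L) of a <= b & b <= c & a <= d & d <= c :
    Id_generators (op3 (iota_fun a b c d)).

End Aggregation.

Arguments Id {disp} L n f.
Arguments Id_generators {disp} L n _.

(* Main.v *)
Require Import Defs.
From mathcomp Require Import all_boot all_order.
Import Order.TTheory.
Local Open Scope order_scope.

(** Write [m] and [M] for the meet and the join of the entries of [x].  Since
    [m <= x i <= M], the [i]-th term indexed by [a] is [f a `&` M] or [M],
    according to whether [(m, x i, M)] is below [(\meet a, a i, \join a)].  That
    happens for every [i] exactly when [x <= a], because [x <= a] forces
    [m <= \meet a] and [M <= \join a].  So the join indexed by [a] is
    [f a `&` M] if [x <= a] and [M] otherwise ([join_iotaE]).  All these values
    lie above [f x], as [f] is monotone and [f x <= M], and the value at
    [a = x] is [f x `&` M = f x] ([iota_formula]).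

    The formula builds [f] out of projections, finite nonempty meets and joins,
    and the functions [iota]; hence every clone with these generators contains
    [f] ([Id_sub_clone]).  Conversely idempotent aggregation functions form a
    clone ([Id_clone]) to which the generators belong ([generators_sub_Id]). *)

Section CloneClosure.

Set Implicit Arguments.
Unset Strict Implicit.

Variables (disp : Order.disp_t) (L : finTBLatticeType disp) (D : op_set L).
Hypothesis cloneD : is_clone D.

Lemma clone_op2 (h : L -> L -> L) n (f g : op L n) :
  D (op2 h) -> D f -> D g -> D ([ffun x => h (f x) (g x)] : op L n).
Proof.
case: cloneD => _ _ compD Dh Df Dg.
have -> : [ffun x => h (f x) (g x)]
          = Defs.comp (op2 h) (fun i : 'I_2 => nth f [:: f; g] i).
  by apply/ffunP=> x; rewrite !ffunE /= !inordK.
by apply: compD => // -[[|[|//]]].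
Qed.

Lemma clone_op3 (h : L -> L -> L -> L) n (f g k : op L n) :
  D (op3 h) -> D f -> D g -> D k ->
  D ([ffun x => h (f x) (g x) (k x)] : op L n).
Proof.
case: cloneD => _ _ compD Dh Df Dg Dk.
have -> : [ffun x => h (f x) (g x) (k x)]
          = Defs.comp (op3 h) (fun i : 'I_3 => nth f [:: f; g; k] i).
  by apply/ffunP=> x; rewrite !ffunE /= !inordK.
by apply: compD => // -[[|[|[|//]]]].
Qed.

(** The index type has to be inhabited: an empty iteration is the constant
    [idx], and a clone need not contain constants.  For the same reason the
    induction starts from a one-element sequence. *)
Lemma clone_bigop (idx : L) (h : Monoid.law idx) (I : finType) (i0 : I) n
    (F : I -> op L n) :
  D (op2 h) -> (forall i, D (F i)) ->
  D ([ffun x => \big[h/idx]_i F i x] : op L n).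
Proof.
move=> Dh DF; have: i0 \in index_enum I by apply: mem_index_enum.
case: (index_enum I) => // i s _ {i0}.
elim: s i => [|j s IHs] i.
  have -> // : [ffun x => \big[h/idx]_(k <- [:: i]) F k x] = F i.
  by apply/ffunP=> x; rewrite ffunE big_seq1.
have -> : [ffun x => \big[h/idx]_(k <- i :: j :: s) F k x]
          = [ffun x => h (F i x)
              (([ffun y => \big[h/idx]_(k <- j :: s) F k y] : op L n) x)].
  by apply/ffunP=> x; rewrite !ffunE big_cons.
exact: clone_op2.
Qed.

End CloneClosure.

Section IdempotentAggregation.

Set Implicit Arguments.
Unset Strict Implicit.

Variables (disp : Order.disp_t) (L : finTBLatticeType disp).

(** Preservation of the two bounds is idempotency at [\bot] and at [\top]. *)
Lemma Id_intro n (f : op L n) :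
  (0 < n)%N ->
  (forall x y : (L ^ n)%type, (forall i, x i <= y i) -> f x <= f y) ->
  Defs.idempotent_op f -> Id L n f.
Proof. by move=> n_gt0 fM fI; split=> //; split=> //; split. Qed.

Lemma Id_clone : is_clone (Id L).
Proof.
split=> [n f [] // | n i | k n f g [k_gt0 [[fM _ _] fI]] IdG].
  apply: Id_intro => [|x y lexy|x]; last by rewrite !ffunE.
    exact: leq_ltn_trans (ltn_ord i).
  by rewrite !ffunE.
apply: Id_intro => [|x y lexy|x].
- by case: (IdG (Ordinal k_gt0)).
- rewrite !ffunE; apply: fM => i; rewrite !ffunE.
  by case: (IdG i) => _ [[gM _ _] _]; apply: gM.
rewrite ffunE -[RHS]fI; congr (f _); apply/ffunP=> i; rewrite !ffunE.
by case: (IdG i) => _ [_].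
Qed.

(** Passing from [x] to a larger [y], the function can only switch from its
    cut-off branch to the plain join, because the box below [(a, b, c)] is a
    down-set. *)
Lemma iota_mono (a b c d x1 x2 x3 y1 y2 y3 : L) :
  x1 <= y1 -> x2 <= y2 -> x3 <= y3 ->
  iota_fun a b c d x1 x2 x3 <= iota_fun a b c d y1 y2 y3.
Proof.
move=> le1 le2 le3; rewrite /iota_fun.
have leU : x1 `|` x2 `|` x3 <= y1 `|` y2 `|` y3 by rewrite !leU2.
case: ifP => [_|nx].
  by case: ifP => _; [rewrite leI2 | apply: le_trans leU; apply: leIr].
case: ifP => // /and3P[y1a y2b y3c].
by rewrite (le_trans le1 y1a) (le_trans le2 y2b) (le_trans le3 y3c) in nx.
Qed.

(** On the diagonal the cut-off applies only below [a], hence below [d]. *)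
Lemma iota_idem (a b c d x : L) : a <= d -> iota_fun a b c d x x x = x.
Proof.
move=> lead; rewrite /iota_fun !joinxx.
by case: ifP => // /and3P[xa _ _]; apply/meet_idPr/(le_trans xa).
Qed.

Lemma generators_sub_Id : op_subset (Id_generators L) (Id L).
Proof.
move=> _ _ [||a b c d _ _ lead _]; apply: Id_intro => // [x y lexy|x].
- by rewrite !ffunE leU2.
- by rewrite !ffunE joinxx.
- by rewrite !ffunE leI2.
- by rewrite !ffunE meetxx.
- by rewrite !ffunE iota_mono.
by rewrite !ffunE iota_idem.
Qed.

(** Internality: compare [x] with the two constant tuples that bound it. *)
Lemma Id_bounds n (f : op L n) (x : (L ^ n)%type) :
  idempotent_aggregation f ->
  \meet_(j < n) x j <= f x <= \join_(j < n) x j.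
Proof.
case=> -[fM _ _] fI; rewrite -{1}[\meet_(j < n) _]fI -[\join_(j < n) _]fI.
by rewrite !fM // => i; rewrite ffunE ?meets_inf ?joins_sup.
Qed.

(** If some [x i <= a i] fails, that single index already contributes the full
    join of [x], which no other term exceeds; otherwise all terms are equal. *)
Lemma join_iotaE n (n_gt0 : (0 < n)%N) (d : L) (a x : (L ^ n)%type) :
  \join_(i < n) iota_fun (\meet_(j < n) a j) (a i) (\join_(j < n) a j) d
                  (\meet_(j < n) x j) (x i) (\join_(j < n) x j)
  = if [forall i, x i <= a i] then d `&` \join_(j < n) x j
    else \join_(j < n) x j.
Proof.
set M := \join_(j < n) x j.
have leM i : x i <= M by rewrite /M joins_sup.
have joinE i : \meet_(j < n) x j `|` x i `|` M = M.
  by apply/join_r; rewrite leUx leM (le_trans _ (leM i)) ?meets_inf.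
rewrite /iota_fun; apply/le_anti/andP; case: forallP => [lexa|nlexa].
- have mle : \meet_(j < n) x j <= \meet_(j < n) a j.
    by apply/meetsP => i _; apply: le_trans (lexa i); rewrite meets_inf.
  have Mle : M <= \join_(j < n) a j.
    by apply/joinsP => i _; apply: le_trans (lexa i) _; rewrite joins_sup.
  split; first by apply/joinsP => i _; rewrite mle lexa Mle joinE.
  apply: le_trans (joins_sup _ (j := Ordinal n_gt0) isT).
  by rewrite mle lexa Mle joinE.
split.
  by apply/joinsP => i _; rewrite joinE; case: ifP => // _; apply: leIr.
have [i nlei] : exists i, ~~ (x i <= a i).
  by apply/existsP; rewrite -negb_forall; apply/forallP.
apply: le_trans (joins_sup _ (j := i) isT).
by rewrite (negPf nlei) andbF joinE.
Qed.

Lemma iota_formula n (f : op L n) (x : (L ^ n)%type) :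
  (0 < n)%N -> idempotent_aggregation f ->
  f x = \meet_(a : (L ^ n)%type) \join_(i < n)
          iota_fun (\meet_(j < n) a j) (a i) (\join_(j < n) a j) (f a)
                   (\meet_(j < n) x j) (x i) (\join_(j < n) x j).
Proof.
move=> n_gt0 Idf; have /andP[_ fxM] := Id_bounds x Idf.
case: (Idf) => -[fM _ _] _.
under eq_bigr => a _ do rewrite (join_iotaE n_gt0).
apply/le_anti/andP; split.
  apply/meetsP => a _; case: forallP => // lexa.
  by rewrite lexI fxM fM.
apply: le_trans (meets_inf _ (j := x) isT) _.
by have -> : [forall i, x i <= x i] by [apply/forallP]; apply: leIl.
Qed.

Lemma Id_sub_clone (D : op_set L) :
  is_clone D -> op_subset (Id_generators L) D -> op_subset (Id L) D.
Proof.
move=> cloneD genD n f [n_gt0 Idf]; case: (cloneD) => _ projD _.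
pose i0 := Ordinal n_gt0.
have Dmeet := genD _ _ (Gen_meet L); have Djoin := genD _ _ (Gen_join L).
pose M : op L n := [ffun x => \join_(j < n) (proj L j) x].
pose m : op L n := [ffun x => \meet_(j < n) (proj L j) x].
have DM : D n M := clone_bigop cloneD i0 Djoin (projD n).
have Dm : D n m := clone_bigop cloneD i0 Dmeet (projD n).
pose G (a : (L ^ n)%type) i : op L n :=
  [ffun x => iota_fun (\meet_(j < n) a j) (a i) (\join_(j < n) a j) (f a)
                      (m x) (proj L i x) (M x)].
have DG a i : D n (G a i).
  have /andP[lef fle] := Id_bounds a Idf.
  apply: clone_op3 => //; apply/genD.
  by apply: Gen_iota; rewrite ?meets_inf ?joins_sup.
have DJ a := clone_bigop cloneD i0 Djoin (DG a).
(* The tuple only witnesses that [L ^ n] is inhabited. *)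
have := clone_bigop cloneD ([ffun=> \bot] : (L ^ n)%type) Dmeet DJ.
congr (D n _); apply/ffunP => x; rewrite ffunE (iota_formula x n_gt0 Idf).
apply: eq_bigr => a _; rewrite ffunE; apply: eq_bigr => i _; rewrite !ffunE.
by congr iota_fun; apply: eq_bigr => j _; rewrite ffunE.
Qed.

End IdempotentAggregation.

Theorem theorem2p8 (disp : Order.disp_t) (L : finTBLatticeType disp) :
  generated_by (Id L) (Id_generators L) /\
  (forall (n : nat) (f : op L n),
     (0 < n)%N -> idempotent_aggregation f ->
     forall x : (L ^ n)%type,
       f x = \meet_(a : (L ^ n)%type) \join_(i < n)
               iota_fun (\meet_(j < n) a j) (a i) (\join_(j < n) a j) (f a)
                        (\meet_(j < n) x j) (x i) (\join_(j < n) x j)).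
Proof.
split; last by move=> n f n_gt0 Idf x; apply: iota_formula.
by split; [apply: Id_clone | apply: generators_sub_Id | apply: Id_sub_clone].
Qed.
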